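(* Let $g\in\mathbb{N}_0$, and let $\mathcal{A}\subset C(\mathbb{T}_{g,q})$, the representation $\pi:\mathcal{A}\to B(\mathcal{H})$ on $\mathcal{H}=\ell_2(\mathbb{N})\oplus\ell_2(\mathbb{N})$, and the operator $D$ be as defined in the context. Then there does not exist an anti-unitary operator $J$ on $\mathcal{H}$ satisfying the first order condition $$[\pi(a),J\pi(b)J^{-1}]=0,\qquad [[D,\pi(a)],J\pi(b)J^{-1}]=0\qquad\text{for all } a,b\in\mathcal{A}.$$
   Context: Toeplitz algebra: Let $u(\mathrm{e}^{\mathrm{i}t})=\mathrm{e}^{\mathrm{i}t}$ be the unitary generator of $C(\mathbb{S}^1)\subset L_2(\mathbb{S}^1)$, and let $e_k=\frac{1}{\sqrt{2\pi}}u^k$, $k\in\mathbb{Z}$, be the standard orthonormal basis of $L_2(\mathbb{S}^1)$. Let $\ell_2(\mathbb{N}):=\overline{\mathrm{span}}\{e_n:n\in\mathbb{N}_0\}$ and let $P$ be the orthogonal projection from $L_2(\mathbb{S}^1)$ onto $\ell_2(\mathbb{N})$. For $f\in C(\mathbb{S}^1)$ define $T_f\in B(\ell_2(\mathbb{N}))$ by $T_f(\phi)=P(f\phi)$. The Toeplitz algebra $\mathcal{T}\subset B(\ell_2(\mathbb{N}))$ is the C*-algebra generated by all $T_f$, $f\in C(\mathbb{S}^1)$. It contains the compact operators $K(\ell_2(\mathbb{N}))$, and the symbol map $\sigma:\mathcal{T}\to C(\mathbb{S}^1)$ is the surjective $*$-homomorphism with kernel $K(\ell_2(\mathbb{N}))$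 determined by $\sigma(T_f)=f$. Quantum surfaces: For $g\geq 1$ and $k=1,\ldots,2g$ define arcs $a_k,a_k^{-1}:[0,1]\to\mathbb{S}^1$ by $a_k(t)=\mathrm{e}^{\pi\mathrm{i}\frac{k-1+t}{2g}}$ and $a_k^{-1}(t)=\mathrm{e}^{\pi\mathrm{i}\frac{2g+k-t}{2g}}$. For $g=0$ use instead the single pair $a_0(t)=\mathrm{e}^{\pi\mathrm{i}t}$, $a_0^{-1}(t)=\mathrm{e}^{-\pi\mathrm{i}t}$. Let $C_g$ be the C*-algebra of all $f\in C(\mathbb{S}^1)$ such that $f(a_k(t))=f(a_k^{-1}(t))$ for all $t\in[0,1]$ and all $k=1,\ldots,2g$ (only $k=0$ if $g=0$). Define $C(\mathbb{T}_{g,q}):=\{x\in\mathcal{T}:\sigma(x)\in C_g\}$, a C*-subalgebra of $\mathcal{T}$. The algebra $\mathcal{A}$: Let $\mathcal{K}_S\subset K(\ell_2(\mathbb{N}))$ be the set of matrices of rapid decay, i.e. operators $A$ with $Ae_n=\sum_{k\in\mathbb{N}_0}a_{kn}e_k$ such that $\lim_{k+n\to\infty}|k^\alpha a_{kn}n^\beta|=0$ for all $\alpha,\beta\in\mathbb{N}_0$ (with $0^0=1$). Let $\mathcal{A}$ be the $*$-algebra generated by $\mathcal{K}_S$ and $\{T_f: f\in C^\infty(\mathbb{S}^1)\cap C_g\}$. Representation and Dirac operator: $\mathcal{H}:=\ell_2(\mathbb{N})\oplus\ell_2(\mathbb{N})$ and $\pi(a)(v_+\oplus v_-):=av_+\oplus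 av_-$. Let $S\in B(\ell_2(\mathbb{N}))$ be the shift $Se_k=e_{k+1}$, $k\in\mathbb{N}_0$, and let $N$ be the self-adjoint number operator $Ne_n=ne_n$ with $\mathrm{dom}(N)=\{\sum_n\alpha_ne_n\in\ell_2(\mathbb{N}):\sum_n n^2|\alpha_n|^2<\infty\}$. Define $D:=\begin{pmatrix}0&S^*N\\ NS&0\end{pmatrix}$ with $\mathrm{dom}(D)=\mathrm{dom}(N)\oplus\mathrm{dom}(N)$. For $a\in\mathcal{A}$, $[D,\pi(a)]$ denotes the bounded extension of the commutator. An anti-unitary operator is a bijective conjugate-linear map $J$ with $\langle Jv,Jw\rangle=\overline{\langle v,w\rangle}$. *)

(* Defs.v *)
From HB Require Import structures.
From mathcomp Require Import all_boot all_order all_algebra.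
From mathcomp Require Import all_classical all_reals all_analysis.
From mathcomp Require Import complex ring lra.

Set Implicit Arguments.
Unset Strict Implicit.
Unset Printing Implicit Defensive.

Import Order.TTheory GRing.Theory Num.Theory.
Import numFieldNormedType.Exports.

Local Open Scope classical_set_scope.
Local Open Scope ring_scope.

(* [R[i]] itself carries no topology in the library; as a [numClosedFieldType]
   it receives the one induced by its norm. *)
Definition Cx (R : realType) : numClosedFieldType := R[i].

(* [`|z|] takes its values in [Cx R], [modulus z] in [R]. *)
Definition modulus (R : realType) (z : Cx R) : R := complex.Re `|z|.

Section SquareSummable.
Variable R : realType.

Definition square_summable (x : nat -> Cx R) : Prop :=
  cvgn (series (fun n => modulus (x n) ^+ 2)).

Definition l2_pred : {pred nat -> Cx R} := fun x => `[< square_summable x >].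

Lemma modulus0 : modulus (0 : Cx R) = 0.
Proof. by rewrite /modulus normr0. Qed.

Lemma modulus_ge0 (z : Cx R) : 0 <= modulus z.
Proof. by rewrite /modulus normc_def /= sqrtr_ge0. Qed.

Lemma modulusM (z w : Cx R) : modulus (z * w) = modulus z * modulus w.
Proof. by rewrite /modulus normrM !normc_def /= mulr0 subr0. Qed.

Lemma modulusD (z w : Cx R) : modulus (z + w) <= modulus z + modulus w.
Proof.
have := ler_normD z w; rewrite /modulus !normc_def.
by rewrite lecE /= => /andP[].
Qed.

Lemma l2_submod_closed : submod_closed l2_pred.
Proof.
split.
  apply/asboolP; rewrite /square_summable.
  rewrite (_ : series _ = fun=> 0); first exact: is_cvg_cst.
  by apply/funext => n; rewrite /series /= big1// => i _; rewrite modulus0 expr0n.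
move=> a x y /asboolP hx /asboolP hy; apply/asboolP.
pose u n : R := modulus (x n) ^+ 2; pose w n : R := modulus (y n) ^+ 2.
apply: (@series_le_cvg _ _ ((2 * modulus a ^+ 2) *: u + 2 *: w)).
- by move=> n; exact: sqr_ge0.
- by move=> n; rewrite addr_ge0// mulr_ge0 ?sqr_ge0// mulr_ge0 ?sqr_ge0.
- move=> n; rewrite !fctE /u /w /GRing.scale/=.
  have := modulusD (a * x n) (y n); rewrite modulusM.
  have := modulus_ge0 (a * x n + y n).
  set m := modulus (_ + _); set p := modulus a; set q := modulus _ => m0 mpq.
  apply: (@le_trans _ _ ((p * q + modulus (y n)) ^+ 2)); last first.
    by rewrite -subr_ge0 (_ : _ - _ = (p * q - modulus (y n)) ^+ 2) ?sqr_ge0//; ring.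
  by rewrite ler_sqr// nnegrE (le_trans m0).
- by apply: is_cvg_seriesD; exact: is_cvg_seriesZ.
Qed.

HB.instance Definition _ :=
  GRing.isSubmodClosed.Build (Cx R) (nat -> Cx R) l2_pred l2_submod_closed.

(* elements of l_2(N), given by their coordinates in the basis (e_n)_n *)
Record l2 : Type := L2 { coord :> nat -> Cx R ; _ : coord \in l2_pred }.

HB.instance Definition _ := [isSub for coord].
HB.instance Definition _ := [Choice of l2 by <:].
HB.instance Definition _ := [SubChoice_isSubLmodule of l2 by <:].

(* the zero vector when [x] is not square summable *)
Definition mkl2 (x : nat -> Cx R) : l2 := insubd (0 : l2) x.

Definition basis (n : nat) : l2 := mkl2 (fun k => (k == n)%:R).

Definition inner (x y : l2) : Cx R :=
  limn (series (fun n => (x n)^* * y n : Cx R)).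

End SquareSummable.

Section Operators.
Variables (R : realType) (V : lmodType (Cx R)) (ip : V -> V -> Cx R).

Definition ip_norm (v : V) : R := Num.sqrt (complex.Re (ip v v)).

Definition bounded_operator : set (V -> V) := [set T | linear T /\
  exists M : R, forall v, ip_norm (T v) <= M * ip_norm v].

Definition adjoint (T : V -> V) : V -> V :=
  xget 0 [set T' | forall v w, ip (T v) w = ip v (T' w)].

Definition star_subalgebra : set (set (V -> V)) := [set M |
  [/\ M `<=` bounded_operator, M 0,
      forall (c : Cx R) S T, M S -> M T -> M (c *: S + T),
      forall S T, M S -> M T -> M (S \o T) &
      forall T, M T -> M (adjoint T)]].

Definition commutator (S T : V -> V) : V -> V := (S \o T) \- (T \o S).

(* [op] is only meaningful on [dom] *)
Record unbounded_operator := UnboundedOperator {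
  dom : set V ;
  op : V -> V }.

(* the bounded extension of D T - T D, defined on the domain of D *)
Definition bounded_commutator (D : unbounded_operator) (T : V -> V) : V -> V :=
  xget 0 [set B | bounded_operator B /\
    forall v, dom D v -> dom D (T v) /\ B v = op D (T v) - T (op D v)].

Definition antiunitary (J : V -> V) : Prop :=
  [/\ bijective J, linear_for (Num.conj \; *:%R) J &
      forall v w, ip (J v) (J w) = (ip v w)^*].

End Operators.

Section Circle.
Variable R : realType.

Definition circle : set (Cx R) := [set z | `|z| = 1].

Lemma expi_circle (t : R) : circle (Complex (cos t) (sin t)).
Proof. by rewrite /circle /= normc_def /= cos2Dsin2 sqrtr1. Qed.

Definition expi (t : R) : circle :=
  exist (fun z => z \in circle) _ (mem_set (expi_circle t)).

Local Notation arclength := (@lebesgue_measure R).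
Local Notation period := `[0, 2 * pi : R]%classic.

Definition circle_integral (phi : circle -> Cx R) : Cx R :=
  Complex (Rintegral arclength period (fun t => complex.Re (phi (expi t))))
          (Rintegral arclength period (fun t => complex.Im (phi (expi t)))).

Definition circle_inner (phi psi : circle -> Cx R) : Cx R :=
  circle_integral (fun z => (phi z)^* * psi z).

Definition sqnorm_L2 (phi : circle -> Cx R) : \bar R :=
  (\int[arclength]_(t in period) (modulus (phi (expi t)) ^+ 2)%:E)%E.

(* representatives of the elements of L_2(S^1) *)
Definition in_L2 (phi : circle -> Cx R) : Prop :=
  [/\ measurable_fun period (fun t => complex.Re (phi (expi t)) : R),
      measurable_fun period (fun t => complex.Im (phi (expi t)) : R) &
      (sqnorm_L2 phi < +oo)%E].

Definition fourier (k : int) (z : circle) : Cx R :=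
  set_val z ^ k / Complex (Num.sqrt (2 * pi)) 0.

(* The inclusion of l_2(N) in L_2(S^1): a representative of the L_2-sum of the
   series \sum_n x_n e_n. *)
Definition hardy (x : l2 R) : circle -> Cx R :=
  xget 0 [set phi | in_L2 phi /\
    (fun n => sqnorm_L2
       (fun z => phi z - \sum_(k < n) x k * fourier k z)) @ \oo --> 0%E].

(* The orthogonal projection P of L_2(S^1) onto l_2(N). *)
Definition hardy_proj (phi : circle -> Cx R) : l2 R :=
  xget 0 [set y | forall x : l2 R,
    circle_inner (hardy x) (phi \- hardy y) = 0].

Definition toeplitz (f : circle -> Cx R) : l2 R -> l2 R :=
  fun x => hardy_proj (fun z => f z * hardy x z).

Definition smooth_circle : set (circle -> Cx R) := [set f |
  forall n t,
    derivable (derive1n n (fun s => complex.Re (f (expi s)) : R)) t 1 /\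
    derivable (derive1n n (fun s => complex.Im (f (expi s)) : R)) t 1].

Definition side_arc (g k : nat) (t : R) : circle :=
  if g is 0 then expi (pi * t)
  else expi (pi * ((k%:R - 1 + t) / (2 * g)%:R)).

Definition side_arc_inv (g k : nat) (t : R) : circle :=
  if g is 0 then expi (- (pi * t))
  else expi (pi * (((2 * g + k)%:R - t) / (2 * g)%:R)).

Definition side_index (g : nat) : set nat :=
  if g is 0 then [set 0%N] else [set k | (1 <= k <= 2 * g)%N].

Definition Cg (g : nat) : set (circle -> Cx R) := [set f |
  continuous f /\
  forall k, side_index g k -> forall t : R, 0 <= t <= 1 ->
    f (side_arc g k t) = f (side_arc_inv g k t)].

End Circle.

Section DiracOperator.
Variable R : realType.

Definition rapid_decay : set (l2 R -> l2 R) := [set A |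
  bounded_operator (@inner R) A /\
  forall (al be : nat) (eps : R), 0 < eps ->
    \forall m \near \oo, forall k n : nat, (k + n = m)%N ->
      modulus (k%:R ^+ al * A (basis R n) k * n%:R ^+ be) < eps].

Definition smooth_algebra (g : nat) : set (l2 R -> l2 R) :=
  smallest (star_subalgebra (@inner R))
    (rapid_decay `|`
     [set toeplitz f | f in @smooth_circle R `&` @Cg R g]).

Definition hilbert : Type := (l2 R * l2 R)%type.

HB.instance Definition _ := GRing.Lmodule.on hilbert.

Definition hilbert_inner (v w : hilbert) : Cx R :=
  inner v.1 w.1 + inner v.2 w.2.

Definition diag_rep (a : l2 R -> l2 R) (v : hilbert) : hilbert :=
  (a v.1, a v.2).

Definition shift (x : l2 R) : l2 R :=
  mkl2 (fun n => if n is m.+1 then x m else 0).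

Definition number_operator : unbounded_operator (l2 R) :=
  UnboundedOperator
    [set x : l2 R | square_summable (fun n => n%:R * x n)]
    (fun x : l2 R => mkl2 (fun n => n%:R * x n)).

Definition dirac_operator : unbounded_operator hilbert :=
  UnboundedOperator
    [set v : hilbert | dom number_operator v.1 /\ dom number_operator v.2]
    (fun v : hilbert =>
       (adjoint (@inner R) shift (op number_operator v.2),
        op number_operator (shift v.1))).

End DiracOperator.

(* Main.v *)
Require Import Defs.
From HB Require Import structures.
From mathcomp Require Import all_boot all_order all_algebra.
From mathcomp Require Import all_classical all_reals all_analysis.
From mathcomp Require Import complex.

Set Implicit Arguments.
Unset Strict Implicit.
Unset Printing Implicit Defensive.

Import Order.TTheory GRing.Theory Num.Theory.
Import numFieldNormedType.Exports.

Local Open Scope classical_set_scope.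
Local Open Scope ring_scope.

(** The algebra contains every matrix unit E_jk, since finite matrices decay
rapidly ([matrix_unit_rapid_decay]).  The operators on H = l_2 (x) C^2 that
commute with all the pi(E_jk) are the 1 (x) m with m a 2 x 2 matrix, so the
condition [pi(a), J pi(b) J^-1] = 0 forces the infinite-dimensional algebra
J pi(A) J^-1 into a 4-dimensional one.

The contradiction is made concrete with vectors.  The operator
Q = J pi(E_00) J^-1 commutes with all the pi(E_jk), and its range is the image
under J of the plane spanned by (e_0, 0) and (0, e_0).  The vector
w = J (e_0, 0) is nonzero and fixed by Q; let k be such that the k-th
coordinate of one of its two components is nonzero.  Then the vectors
pi(E_jk) w, for j = 0, 1, 2, are linearly independent ([matrix_units_free]),
yet they all lie in the range of Q, so that J^-1 sends them into a plane.
Since J is conjugate-linear, a linear relation among the images under J^-1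
([exists_left_kernel]) gives one among the vectors themselves
([no_commuting_conjugation]). *)

(** * Coordinates and norms in l_2 *)

Section MatrixUnits.
Variable R : realType.
Implicit Types (x y : l2 R) (w : hilbert R) (c : Cx R).

Local Notation e_ := (Defs.basis R).

Lemma square_summable_basis n :
  square_summable (fun k => (k == n)%:R : Cx R).
Proof.
apply: (cvgP (1 : R)); apply: cvg_near_cst.
exists n.+1 => // m /= nm; rewrite /series /=.
rewrite (bigD1_seq n) ?mem_iota ?iota_uniq ?subn0//= eqxx.
rewrite big1 => [|i /negbTE ->]; last by rewrite modulus0 expr0n.
by rewrite /modulus normr1 expr1n addr0.
Qed.

Lemma basisE n k : e_ n k = (k == n)%:R.
Proof.
have summable_e : (fun k => (k == n)%:R : Cx R) \in @l2_pred R.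
  by apply/asboolP; exact: square_summable_basis.
by rewrite -[LHS]/(val (insubd (0 : l2 R) _) k) insubdK.
Qed.

Lemma basisZE c n k : (c *: e_ n) k = c * (k == n)%:R.
Proof. by rewrite -basisE. Qed.

Lemma sum_basisE n (a : 'I_n -> Cx R) i :
  (\sum_j a j *: e_ j) (i : 'I_n) = a i.
Proof.
rewrite (big_morph (fun x : l2 R => x i) (fun _ _ => erefl) erefl).
under eq_bigr do rewrite basisZE.
rewrite (bigD1 i)//= eqxx mulr1 big1 ?addr0// => j /negbTE ji.
by rewrite eq_sym (inj_eq val_inj) ji mulr0.
Qed.

Lemma l2P x y : (x : nat -> Cx R) =1 y -> x = y.
Proof. by move=> xy; apply/val_inj/funext. Qed.

(** The inner product is a limit taken in [Cx R], whereas square summability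
is about limits in [R]; this transfers the latter to the former. *)
Lemma cvg_realC (u : nat -> R) (r : R) :
  u @ \oo --> r -> (fun n => (u n)%:C%C : Cx R) @ \oo --> (r%:C%C : Cx R).
Proof.
move=> /cvgrPdist_lt ur; apply/cvgrPdist_lt => e e0.
(* a positive element of [Cx R] is real *)
have eE : e = (complex.Re e)%:C%C.
  move: e0; rewrite ltcE => /andP[/eqP Ime _].
  by apply/eqP; rewrite eq_complex/= Ime !eqxx.
have e0' : 0 < complex.Re e by rewrite -ltcR -eE.
move: (ur _ e0'); apply: filterS => n.
by rewrite eE -rmorphB /= normc_def /= expr0n /= addr0 sqrtr_sqr ltcR.
Qed.

Lemma inner_normE x :
  inner x x = (limn (series (fun n => modulus (x n) ^+ 2)))%:C%C.
Proof.
rewrite /inner (_ : series _ =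
  fun n => (series (fun n => modulus (x n) ^+ 2) n)%:C%C); last first.
  apply/funext => n; rewrite /series /= rmorph_sum; apply: eq_bigr => i _ /=.
  rewrite mulrC -normCK; apply/eqP.
  by rewrite /modulus normc_def /= rmorphXn.
apply: cvg_lim => //; apply: cvg_realC.
by have /asboolP := valP x.
Qed.

Lemma modulus_le_norm x k : modulus (x k) <= ip_norm (@inner R) x.
Proof.
rewrite /ip_norm inner_normE /= -[leLHS]ger0_norm ?modulus_ge0// -sqrtr_sqr.
apply: ler_wsqrtr.
set u := fun n => modulus (x n) ^+ 2.
have u0 n : 0 <= u n by exact: sqr_ge0.
(* the k-th term is bounded by the partial sum that ends with it *)
apply: le_trans (nondecreasing_cvgn_le _ _ k.+1).
- by rewrite /series /= big_nat_recr //= lerDr sumr_ge0.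
- by apply: nondecreasing_series => n _ _; exact: u0.
- by have /asboolP := valP x.
Qed.

Lemma ip_norm_basisZ c j : ip_norm (@inner R) (c *: e_ j) = modulus c.
Proof.
rewrite /ip_norm inner_normE /= (_ : limn _ = modulus c ^+ 2).
  by rewrite sqrtr_sqr ger0_norm ?modulus_ge0.
apply: cvg_lim => //; apply: cvg_near_cst.
exists j.+1 => // m /= jm.
rewrite [LHS](_ : _ = \sum_(0 <= i < m) modulus (c * (i == j)%:R) ^+ 2).
  rewrite (bigD1_seq j) ?mem_iota ?iota_uniq ?subn0//= eqxx mulr1.
  rewrite big1 ?addr0// => i /negbTE ->.
  by rewrite mulr0 modulus0 expr0n.
by apply: eq_bigr => i _; rewrite -basisZE.
Qed.

(** * Matrix units *)

Definition matrix_unit (j k : nat) : l2 R -> l2 R := fun x => x k *: e_ j.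

Lemma matrix_unit_rapid_decay j k : rapid_decay (matrix_unit j k).
Proof.
split; first split.
- by move=> c x y; rewrite /matrix_unit scalerA -scalerDl.
- by exists 1 => x; rewrite mul1r ip_norm_basisZ modulus_le_norm.
(* the only nonzero entry lies on the antidiagonal of index [j + k] *)
move=> al be eps eps0; exists (j + k).+1 => // m jkm p n pnm.
have -> : matrix_unit j k (e_ n) p = (k == n)%:R * (p == j)%:R.
  by rewrite /matrix_unit basisZE basisE.
case: eqP => [kn|_]; last by rewrite mul0r mulr0 mul0r modulus0.
case: eqP => [pj|_]; last by rewrite !mulr0 mul0r modulus0.
by move: jkm; rewrite /= -pnm kn pj ltnn.
Qed.

Lemma diag_matrix_unit_basis j :
  diag_rep (matrix_unit j j) (e_ j, 0) = (e_ j, 0).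
Proof.
rewrite /diag_rep /matrix_unit /= basisE eqxx scale1r; congr pair.
exact: scale0r.
Qed.

Lemma hilbert_neq0 w : w <> 0 -> exists k, (w.1 k != 0) || (w.2 k != 0).
Proof.
move=> w_neq0; apply: contrapT => /forallNP w_eq0; apply: w_neq0.
rewrite [w]surjective_pairing; congr pair; apply: l2P => k;
  by have /negP := w_eq0 k; rewrite negb_or !negbK => /andP[/eqP ? /eqP ?].
Qed.

Lemma sum_hilbert n (x y : 'I_n -> l2 R) :
  \sum_i ((x i, y i) : hilbert R) = (\sum_i x i, \sum_i y i).
Proof.
rewrite [LHS]surjective_pairing; congr pair.
  exact: (big_morph (fst : hilbert R -> l2 R) (fun _ _ => erefl) erefl).
exact: (big_morph (snd : hilbert R -> l2 R) (fun _ _ => erefl) erefl).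
Qed.

(** E_jk moves the k-th coordinates of [w] to position j, so the j-th
coordinates of a combination of the pi(E_jk) w isolate its j-th coefficient. *)
Lemma matrix_units_free n (c : 'I_n -> Cx R) k w :
  (w.1 k != 0) || (w.2 k != 0) ->
  \sum_i c i *: diag_rep (matrix_unit i k) w = 0 -> forall i, c i = 0.
Proof.
move=> wk sum0 i.
have : \sum_i (((c i * w.1 k) *: e_ i, (c i * w.2 k) *: e_ i) : hilbert R) = 0.
  rewrite -[RHS]sum0; apply: eq_bigr => j _.
  by rewrite -!scalerA.
rewrite sum_hilbert.
move=> -[/(congr1 (fun x : l2 R => x i)) + /(congr1 (fun x : l2 R => x i))].
rewrite !sum_basisE => /eqP + /eqP; rewrite !mulf_eq0.
by move: wk; case: (c i =P 0) => //= _ /orP[]/negbTE->.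
Qed.

End MatrixUnits.

(** * Conjugations that make the matrix units commute *)

Lemma exists_left_kernel (F : fieldType) (m n : nat) (M : 'M[F]_(m, n)) :
  (n < m)%N -> exists2 c : 'rV_m, c *m M = 0 & c != 0.
Proof.
move=> nm; have /rowV0Pn[c /sub_kermxP cM c0] : kermx M != 0; last by exists c.
rewrite -mxrank_eq0 mxrank_ker subn_eq0 -ltnNge.
by rewrite (leq_ltn_trans (rank_leq_col M)).
Qed.

(** A conjugate-linear bijection J would carry the plane of the vectors
(a e_0, b e_0) onto a subspace invariant under all the matrix units, and such a
subspace is zero or infinite-dimensional. *)
Lemma no_commuting_conjugation (R : realType) (J Jinv : hilbert R -> hilbert R) :
  linear_for (Num.conj \; *:%R) J -> cancel J Jinv -> cancel Jinv J ->
  ~ forall i j k l v,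
    diag_rep (matrix_unit i j) (J (diag_rep (matrix_unit k l) (Jinv v))) =
    J (diag_rep (matrix_unit k l) (Jinv (diag_rep (matrix_unit i j) v))).
Proof.
move=> Jlin JK JinvK commutes.
have J0 : J 0 = 0.
  have := Jlin (-1) 0 0.
  by rewrite scaler0 addr0 /= rmorphN1 scaleN1r addNr.
have Jsum n (c : 'I_n -> Cx R) (v : 'I_n -> hilbert R) :
    J (\sum_i c i *: v i) = \sum_i (c i)^* *: J (v i).
  elim/big_rec2: _ => // i _ s _ <-; exact: Jlin.
set p : hilbert R := (Defs.basis R 0, 0); pose w := J p.
have [k wk] : exists k, (w.1 k != 0) || (w.2 k != 0).
  apply: hilbert_neq0 => w0.
  have : p = 0 by rewrite -[p]JK -/w w0 -J0 JK.
  move=> /(congr1 (fun v : hilbert R => v.1 0%N)).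
  by rewrite [LHS]basisE => /eqP; rewrite oner_eq0.
pose f j := diag_rep (matrix_unit j k) w.
(* as [w] is fixed by Q = J pi(E_00) J^-1, so is every [f j] *)
have f_range j : Jinv (f j) = diag_rep (matrix_unit 0 0) (Jinv (f j)).
  by rewrite -[RHS]JK -commutes JK diag_matrix_unit_basis.
(* row [i] holds the coordinates of [Jinv (f i)] on (e_0, 0) and (0, e_0) *)
pose M : 'M[Cx R]_(3, 2) :=
  \matrix_(i, s) (if s == 0 then (Jinv (f i)).1 0%N else (Jinv (f i)).2 0%N).
have [//|c cM c0] := @exists_left_kernel _ _ _ M.
have sum0 : \sum_i c 0 i *: Jinv (f i) = 0.
  transitivity (\sum_i (((c 0 i * M i 0) *: Defs.basis R 0,
                         (c 0 i * M i 1) *: Defs.basis R 0) : hilbert R)).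
    by apply: eq_bigr => i _; rewrite f_range !mxE -!scalerA.
  have cM0 s : \sum_i c 0 i * M i s = 0.
    by have := congr1 (fun A : 'rV_2 => A 0 s) cM; rewrite !mxE.
  by rewrite sum_hilbert -!scaler_suml !cM0 scale0r.
move/negP: c0; apply; apply/eqP/rowP => i; rewrite mxE.
apply: (inv_inj (@conjCK _)); rewrite rmorph0.
apply: (matrix_units_free (c := fun i => (c 0 i)^*) wk).
rewrite -[RHS]J0 -[in RHS]sum0 Jsum.
by apply: eq_bigr => j _; rewrite JinvK.
Qed.

Theorem proposition3p5 (R : realType) (g : nat) :
  ~ exists J Jinv : hilbert R -> hilbert R,
      [/\ antiunitary (@hilbert_inner R) J, cancel J Jinv, cancel Jinv J &
        forall a b : l2 R -> l2 R,
          smooth_algebra g a -> smooth_algebra g b ->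
          commutator (diag_rep a) (J \o diag_rep b \o Jinv) = 0 /\
          commutator
            (bounded_commutator (@hilbert_inner R) (dirac_operator R) (diag_rep a))
            (J \o diag_rep b \o Jinv) = 0].
Proof.
move=> [J [Jinv [[_ Jlin _] JK JinvK first_order]]].
have unit_in j k : smooth_algebra g (@matrix_unit R j k).
  by apply: sub_gen_smallest; left; exact: matrix_unit_rapid_decay.
apply: (no_commuting_conjugation Jlin JK JinvK) => i j k l v.
have [/(congr1 (fun T => T v)) + _] :=
  first_order _ _ (unit_in i j) (unit_in k l).
by move/eqP; rewrite subr_eq0 => /eqP.
Qed.
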